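(* Fix $0<\epsilon\le 1$. Let $f(X)\in\mathbb{Z}[X]$ be a monic polynomial whose roots in $\bar{\mathbb{Q}}$ are not roots of unity, and suppose that there are integers $m\ge2$ and $n\ge\max\{2,\epsilon\deg(f)\}$ such that $\Phi_{n-1}(X)=X^{n-1}+X^{n-2}+\cdots+X+1$ divides $f(X)$ in $(\mathbb{Z}/m\mathbb{Z})[X]$. Then $$\sum_{f(\alpha)=0}h(\alpha)\ \ge\ \frac{\log m}{185\,\epsilon^{-1}\log(24\,\epsilon^{-1})}.$$ In particular, Lehmer's conjecture is true for the set of all such polynomials, i.e. there is a constant $C>0$ (depending on $\epsilon$) such that $\sum_{f(\alpha)=0}h(\alpha)\ge C$ for all such $f$.
   Context: $h:\bar{\mathbb{Q}}\to[0,\infty)$ is the absolute logarithmic (Weil) height: for $\alpha$ in a number field $K$, $h(\alpha)=\sum_{v\in M_K}\max\{\log\|\alpha\|_v,0\}$, where $M_K$ is the set of absolute values on $K$ extending the usual absolute values of $\mathbb{Q}$ and $\|\alpha\|_v=|\alpha|_v^{[K_v:\mathbb{Q}_v]/[K:\mathbb{Q}]}$. Sums over the roots of $f$ are over the roots in $\bar{\mathbb{Q}}$ counted with multiplicity. *)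

(* Defs.v *)
From mathcomp Require Import all_boot all_order all_algebra all_field.
From mathcomp Require Import boolp classical_sets functions cardinality fsbigop.
From mathcomp Require Import reals exp.
Set Implicit Arguments.
Unset Strict Implicit.
Unset Printing Implicit Defensive.
Import Order.TTheory GRing.Theory Num.Theory.
Local Open Scope classical_set_scope.
Local Open Scope ring_scope.

Record is_absolute_value (R : realType) (F : fieldType) (v : F -> R) : Prop :=
  IsAbsoluteValue {
    absv_ge0 : forall x, 0 <= v x;
    absv_eq0 : forall x, v x = 0 <-> x = 0;
    absvM : forall x y, v (x * y) = v x * v y;
    absv_triangle : forall x y, v (x + y) <= v x + v y }.

Definition arch_absv (R : realType) (q : rat) : R := ratr `|q|.

(* |a/b|_p = p^(v_p(b) - v_p(a)); the case q = 0 is separate because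
   logn p 0 = 0. *)
Definition padic_absv (R : realType) (p : nat) (q : rat) : R :=
  if q == 0 then 0
  else p%:R ^+ logn p `|denq q|%N / p%:R ^+ logn p `|numq q|%N.

(* M_K. Equality is equality of functions, so each place of K is counted once,
   through its representative extending a usual absolute value of Q. *)
Definition places (R : realType) (K : fieldExtType rat) : set (K -> R) :=
  [set v | is_absolute_value v /\
     ((forall q : rat, v q%:A = arch_absv R q) \/
      (exists2 p : nat, prime p & forall q : rat, v q%:A = padic_absv R p q))].

Definition absv_complete (R : realType) (F : fieldType) (w : F -> R) : Prop :=
  forall u : nat -> F,
    (forall e : R, 0 < e ->
       exists N : nat, forall i j : nat,
         (N <= i)%N -> (N <= j)%N -> w (u i - u j) < e) ->
    exists l : F, forall e : R, 0 < e ->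
      exists N : nat, forall i : nat, (N <= i)%N -> w (u i - l) < e.

(* (Fhat, w), with the embedding iota, is a completion of (F, v). *)
Record is_completion (R : realType) (F : fieldType) (v : F -> R)
    (Fhat : fieldType) (w : Fhat -> R) (iota : {rmorphism F -> Fhat}) : Prop :=
  IsCompletion {
    completion_absv : is_absolute_value w;
    completion_ext : forall x, w (iota x) = v x;
    completion_dense : forall (y : Fhat) (e : R), 0 < e ->
      exists x : F, w (y - iota x) < e;
    completion_complete : absv_complete w }.

(* n = [K_v : Q_v]: Kv is a completion of K at v, and the scalar field Qv of
   the finite extension Kv is the completion of Q at the restriction of v,
   with the absolute value induced by that of Kv. The embeddings of Q into Kv
   through K and through Qv agree because Q has at most one ring morphism to
   any field. *)
Definition is_local_degree (R : realType) (K : fieldExtType rat) (v : K -> R)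
    (n : nat) : Prop :=
  exists (Qv : fieldType) (Kv : fieldExtType Qv) (w : Kv -> R)
         (iota : {rmorphism K -> Kv}) (j : {rmorphism rat -> Qv}),
    [/\ is_completion v w iota,
        is_completion (fun q : rat => v q%:A) (fun c : Qv => w c%:A) j
      & n = \dim {: Kv}].

(* Completions are unique up to isometric isomorphism, so at most one n
   satisfies is_local_degree; the default 0 is never used for a place v. *)
Definition local_degree (R : realType) (K : fieldExtType rat) (v : K -> R)
    : nat := xget 0%N [set n | is_local_degree v n].

Definition normalized_absv (R : realType) (K : fieldExtType rat) (v : K -> R)
    (x : K) : R :=
  v x `^ ((local_degree v)%:R / (\dim {: K})%:R).

(* The sum has finite support. As ln 0 = 0, the summands vanish at x = 0,
   in agreement with max (log 0) 0 = 0 for log 0 = -oo. *)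
Definition nf_height (R : realType) (K : fieldExtType rat) (x : K) : R :=
  \sum_(v \in @places R K) Num.max (ln (normalized_absv v x)) 0.

(* The height on the algebraic numbers, computed in the number field
   K = Q(a); the value does not depend on the number field containing a. *)
Definition weil_height (R : realType) (a : algC) : R :=
  let: existT K (existT _ (exist2 s _ _)) := num_field_exists [:: a] in
  nf_height R (head (0 : K) s).

Definition alg_poly (f : {poly int}) : {poly algC} :=
  map_poly (fun z : int => z%:~R) f.

(* The roots in algC, repeated according to multiplicity. *)
Definition alg_roots (f : {poly int}) : seq algC :=
  sval (closed_field_poly_normal (alg_poly f)).

Definition root_height_sum (R : realType) (f : {poly int}) : R :=
  \sum_(a <- alg_roots f) weil_height R a.

Definition no_cyclotomic_root (f : {poly int}) : Prop :=
  forall a : algC, root (alg_poly f) a ->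
    ~ exists2 k : nat, (0 < k)%N & k.-unity_root a.

(* Divisibility in (Z/m)[X], for 1 < m: 'Z_m is the ring Z/m only then. *)
Definition divides_mod (m : nat) (g f : {poly int}) : Prop :=
  exists q : {poly 'Z_m},
    map_poly (fun z : int => z%:~R) f = q * map_poly (fun z : int => z%:~R) g.

(* all_ones_poly d = X^d + ... + X + 1 *)
Definition all_ones_poly (d : nat) : {poly int} := \sum_(i < d.+1) 'X^i.

Definition admissible (R : realType) (eps : R) (f : {poly int}) (m n : nat)
    : Prop :=
  [/\ f \is monic,
      no_cyclotomic_root f,
      (2 <= m)%N,
      Num.max 2 (eps * (size f).-1%:R) <= n%:R
    & divides_mod m (all_ones_poly n.-1) f].

(* Main.v *)
(* For monic f the sum of the heights of the roots is at least
   mu = sum_(f b = 0) log max(1, |b|), the sum being over the complex roots: the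
   height of a is bounded below by the contribution of the archimedean places of
   Q(a), which are the absolute values |sigma x| with local degree 1 or 2
   according to whether sigma is real.

   Writing f = q Phi_(n-1) + m g, the resultant of f and Phi_(n-1) is m^(n-1)
   times an integer and is not 0, hence prod_b |b^(nk) - 1| >= m^(n-1) for every
   k >= 1. On the other hand prod_(i<j<N) |1 - w^(j-i)| is, for |w| = 1, the
   absolute value of a Vandermonde determinant with unimodular entries, and it is
   at most N! max(1,|w|)^(N(N^2-1)/6) for every w. Taking w = b^n and multiplying over all b gives
     (n-1) N(N-1)/2 log m <= deg(f) log N! + n N(N^2-1)/6 mu,
   and the bound follows with N of size 64 eps^-1 log(24 eps^-1). *)
Require Import Defs.
From mathcomp Require Import all_boot all_order all_algebra all_field.
From mathcomp Require Import boolp classical_sets functions cardinality fsbigop.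
From mathcomp Require Import reals exp.
From HB Require Import structures.
From mathcomp Require Import finmap perm sequences complex zify ring lra.
Set Implicit Arguments.
Unset Strict Implicit.
Unset Printing Implicit Defensive.
Import Order.TTheory GRing.Theory Num.Theory.
Local Open Scope ring_scope.

(** * The complex numbers as an extension of the reals *)

(** The coordinates are the real and imaginary parts. With the two instances below, [Rcomplex F]
    becomes a field extension of [F] of dimension 2, as [is_local_degree] requires of C over R. *)
Lemma Rcomplex_vector_axiom (F : rcfType) : Vector.axiom 2 (Rcomplex F).
Proof.
pose h (z : Rcomplex F) : 'rV[F]_2 :=
  \row_(i < 2) (if i == 0 then complex.Re z else complex.Im z).
exists h.
  by move=> a x y; apply/rowP => i; rewrite !mxE; case: ifP => _; rewrite linearP.
exists (fun r : 'rV[F]_2 => Complex (r 0 0) (r 0 1) : Rcomplex F).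
  by case=> a b; rewrite /h !mxE.
move=> r; apply/rowP => i; rewrite !mxE.
by case: i => -[|[|//]] p; congr (r _ _); exact/val_inj.
Qed.

HB.instance Definition _ (F : rcfType) :=
  Lmodule_hasFinDim.Build F (Rcomplex F) (Rcomplex_vector_axiom F).

HB.instance Definition _ (F : rcfType) :=
  GRing.Lalgebra_isComAlgebra.Build F (Rcomplex F).

Local Notation normc := ComplexField.Normc.normc.

(** The limit is the lower limit of the sequence: the supremum of [S], the set of numbers eventually
    below it. If the tail from [N] on stays within [e] of [u N], so does [sup S]. *)
Lemma absv_complete_real (R : realType) : absv_complete (fun x : R => `|x|).
Proof.
move=> u cu.
pose S : set R := [set x | exists N : nat, forall i, (N <= i)%N -> x <= u i]%classic.
have near N e : (forall i j, (N <= i)%N -> (N <= j)%N -> `|u i - u j| < e) ->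
    `|u N - sup S| <= e.
  move=> uN.
  have lb : S (u N - e).
    by exists N => i Ni; have := uN N i (leqnn _) Ni; rewrite ltr_norml; lra.
  have ub : ubound S (u N + e).
    move=> x [M xM].
    have := xM (maxn M N) (leq_maxl _ _).
    by have := uN (maxn M N) N (leq_maxr _ _) (leqnn _); rewrite ltr_norml; lra.
  have h1 : sup S <= u N + e by apply: ge_sup => //; exists (u N - e).
  have h2 : u N - e <= sup S by apply: ub_le_sup => //; exists (u N + e).
  by rewrite ler_norml; lra.
exists (sup S) => e e0.
have e2 : 0 < e / 3 by lra.
have [N uN] := cu _ e2; exists N => i Ni.
have := near _ _ uN; have := uN i N Ni (leqnn _).
have := ler_normD (u i - u N) (u N - sup S); rewrite subrKA; lra.
Qed.

Section Complex.
Variable R : rcfType.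
Implicit Types x y z : R[i].

Lemma normc_ge0 z : 0 <= normc z.
Proof. by case: z => a b; exact: sqrtr_ge0. Qed.

Lemma normc_real (a : R) : normc a%:C%C = `|a|.
Proof. by rewrite /= expr0n addr0 sqrtr_sqr. Qed.

Lemma normc_ge_normRe z : `|complex.Re z| <= normc z.
Proof. by case: z => a b /=; rewrite -sqrtr_sqr ler_wsqrtr // lerDl sqr_ge0. Qed.

Lemma normc_ge_normIm z : `|complex.Im z| <= normc z.
Proof. by case: z => a b /=; rewrite -sqrtr_sqr ler_wsqrtr // lerDr sqr_ge0. Qed.

Lemma normc_le_ReIm z : normc z <= `|complex.Re z| + `|complex.Im z|.
Proof.
case: z => a b; rewrite -[Complex a b]/(Complex a b : Rcomplex R).
have -> : Complex a b = a%:C%C + Complex 0 b by rewrite /real_complex_def; simpc.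
apply: le_trans (le_normcD _ _) _.
by rewrite normc_real /= expr0n !add0r !addr0 sqrtr_sqr.
Qed.

End Complex.

Lemma normc_absv (R : realType) : is_absolute_value (fun z : R[i] => normc z).
Proof.
split=> [x|x|x y|x y].
- exact: normc_ge0.
- by split=> [/ComplexField.Normc.eq0_normc|->]; rewrite ?ComplexField.Normc.normc0.
- exact: ComplexField.Normc.normcM.
- exact: le_normcD.
Qed.


Lemma absv_complete_complex (R : realType) :
  absv_complete (fun z : Rcomplex R => normc z).
Proof.
move=> u cu.
have [a ha] : exists l, forall e : R, 0 < e -> exists N : nat, forall i,
    (N <= i)%N -> `|complex.Re (u i) - l| < e.
  apply: absv_complete_real => e /cu[N uN]; exists N => i j Ni Nj.
  rewrite -raddfB; exact: le_lt_trans (normc_ge_normRe _) (uN i j Ni Nj).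
have [b hb] : exists l, forall e : R, 0 < e -> exists N : nat, forall i,
    (N <= i)%N -> `|complex.Im (u i) - l| < e.
  apply: absv_complete_real => e /cu[N uN]; exists N => i j Ni Nj.
  rewrite -raddfB; exact: le_lt_trans (normc_ge_normIm _) (uN i j Ni Nj).
exists (Complex a b) => e e0; have e2 : 0 < e / 2 by lra.
have [N aN] := ha _ e2; have [M bM] := hb _ e2.
exists (maxn N M) => i; rewrite geq_max => /andP[Ni Mi].
apply: le_lt_trans (normc_le_ReIm _) _.
rewrite !raddfB /=; have := aN _ Ni; have := bM _ Mi; lra.
Qed.

Lemma rat_dense (R : realType) (y e : R) : 0 < e ->
  exists q : rat, `|y - ratr q| < e.
Proof.
move=> e0; have [|q] := @rat_in_itvoo _ (y - e) (y + e); first by lra.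
by rewrite in_itv /= => /andP[h1 h2]; exists q; rewrite ltr_norml; lra.
Qed.

Lemma normr_absv (R : realType) : is_absolute_value (fun x : R => `|x|).
Proof.
split=> [x|x|x y|x y]; rewrite ?normr_ge0 ?normrM ?ler_normD //.
by split=> [/normr0_eq0|->]; rewrite ?normr0.
Qed.

Lemma rat_completion (R : realType) :
  is_completion (@arch_absv R) (fun c : R => `|c|) (@ratr R).
Proof.
split; [exact: normr_absv| | exact: rat_dense | exact: absv_complete_real].
by move=> q; rewrite /arch_absv ratr_norm.
Qed.

(** * Places attached to complex embeddings *)

Definition embedding_absv (R : realType) (K : fieldExtType rat)
  (sigma : {rmorphism K -> R[i]}) (y : K) : R := normc (sigma y).

Section EmbeddingPlace.
Variables (R : realType) (K : fieldExtType rat) (sigma : {rmorphism K -> R[i]}).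

Local Notation v := (embedding_absv sigma).

Lemma embedding_rat (q : rat) : sigma q%:A = (ratr q)%:C%C.
Proof.
rewrite alg_num_field fmorph_rat.
by rewrite -(fmorph_eq_rat [the {rmorphism rat -> R[i]} of real_complex R \o ratr]).
Qed.

Lemma embedding_absv_rat q : v q%:A = arch_absv R q.
Proof. by rewrite /embedding_absv embedding_rat normc_real -ratr_norm. Qed.

Lemma embedding_place : places v.
Proof.
split; last by left; exact: embedding_absv_rat.
have [n0 nE nM nD] := normc_absv R.
split=> [x|x|x y|x y]; rewrite /embedding_absv ?rmorphM ?rmorphD //.
rewrite nE; split=> [/eqP|->]; last exact: rmorph0.
by rewrite fmorph_eq0 => /eqP.
Qed.

Lemma embedding_absv_restr :
  (fun q : rat => v q%:A) = @arch_absv R.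
Proof. by apply/funext => q; exact: embedding_absv_rat. Qed.

Lemma real_embedding : (forall y, complex.Im (sigma y) = 0) ->
  exists tau : {rmorphism K -> R}, forall y, sigma y = (tau y)%:C%C.
Proof.
move=> sR; pose f y := complex.Re (sigma y).
have fE y : sigma y = (f y)%:C%C by have := sR y; rewrite /f; case: (sigma y) => a b /= ->.
have fB : zmod_morphism f.
  by move=> x y; rewrite /f rmorphB raddfB.
have fM : monoid_morphism f.
  split=> [|x y]; first by rewrite /f rmorph1.
  apply: (@complexI R); rewrite -fE rmorphM !fE.
  by rewrite -(rmorphM (real_complex R)).
pose fa := GRing.isZmodMorphism.Build K R f fB.
pose fm := GRing.isMonoidMorphism.Build K R f fM.
by exists (HB.pack_for {rmorphism K -> R} f fa fm).
Qed.

Lemma real_local_degree : (forall y, complex.Im (sigma y) = 0) ->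
  is_local_degree v 1.
Proof.
move=> /real_embedding[tau tauE].
exists R, R^o, (fun x => `|x|), tau, ratr; split.
- split; [exact: normr_absv | | | exact: absv_complete_real].
    by move=> x; rewrite /embedding_absv tauE normc_real.
  move=> y e /(rat_dense y)[q qe]; exists q%:A.
  by rewrite alg_num_field fmorph_rat.
- rewrite embedding_absv_restr.
  have -> : (fun c : R => `|c%:A : R^o|) = (fun c : R => `|c|).
    by apply/funext => c; congr `|_|; rewrite -[c%:A]/(c * 1) mulr1.
  exact: rat_completion.
- by rewrite regular_fullv dimv1.
Qed.

(** Here K_v = C: the image of K contains Q + Q sigma(t), which is dense because sigma(t) is not
    real. *)
Lemma complex_local_degree (t : K) : complex.Im (sigma t) != 0 ->
  is_local_degree v 2.
Proof.
move=> t0.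
exists R, (Rcomplex R), (fun x => normc x), (sigma : {rmorphism K -> Rcomplex R}), ratr.
split.
- split; [exact: normc_absv | by [] | | exact: absv_complete_complex].
  move=> [a b] e e0; set c := complex.Im (sigma t) in t0.
  have c0 : 0 < `|c| by rewrite normr_gt0.
  (* [q2] first matches the imaginary part up to e/2, whence the division by |c|; [q1] then corrects
     the real part. *)
  have [q2 hq2] := rat_dense (b / c) (divr_gt0 (divr_gt0 e0 (ltr0n R 2)) c0).
  have [q1 hq1] := rat_dense (a - ratr q2 * complex.Re (sigma t))
    (divr_gt0 e0 (ltr0n R 2)).
  exists (q1%:A + q2%:A * t).
  apply: le_lt_trans (normc_le_ReIm _) _.
  rewrite rmorphD rmorphM !embedding_rat.
  move: (erefl c) hq1; rewrite {1}/c; case: (sigma t) => x y /= -> hq1.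
  rewrite [e]splitr; apply: ltrD.
    by rewrite (_ : _ - _ = a - ratr q2 * x - ratr q1) //; ring.
  rewrite (_ : _ - _ = (b / c - ratr q2) * c); last by field.
  by rewrite normrM -ltr_pdivlMr.
- rewrite embedding_absv_restr.
  have -> : (fun c : R => normc (c%:A : Rcomplex R)) = (fun c : R => `|c|).
    apply/funext => c; rewrite -normc_real; congr normc.
    by rewrite -[c%:A]/(Complex (c * 1) (c * 0)) mulr1 mulr0.
  exact: rat_completion.
- by rewrite dimvf.
Qed.

Lemma is_local_degree_gt0 n : is_local_degree v n -> (0 < n)%N.
Proof. by case=> Qv [Kv [w [iota [j [_ _ ->]]]]]; exact: adim_gt0. Qed.

(* If Kv = Qv then Q is dense in K for v, whereas rationals stay at distance
   at least |Im (sigma t)| from t. *)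
Lemma is_local_degree_gt1 (t : K) n : complex.Im (sigma t) != 0 ->
  is_local_degree v n -> (1 < n)%N.
Proof.
move=> t0 vn; have n0 := is_local_degree_gt0 vn.
rewrite ltn_neqAle n0 andbT; apply/eqP => n1.
case: vn => Qv [Kv [w [iota [j [[wabs wE _ _] [_ _ Qdense _] nE]]]]].
have /vlineP[c cE] : iota t \in <[1 : Kv]>%VS.
  suff -> : (<[1 : Kv]> = fullv)%VS by exact: memvf.
  by apply/eqP; rewrite eqEdim subvf -nE -n1 dim_vline oner_eq0.
have [q] := Qdense c `|complex.Im (sigma t)| (ltac:(by rewrite normr_gt0)).
rewrite ltNge => /negP; apply.
rewrite scalerBl -cE.
have -> : (j q)%:A = iota q%:A.
  rewrite alg_num_field [j q]fmorph_eq_rat fmorph_rat.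
  rewrite -(fmorph_eq_rat [the {rmorphism rat -> Kv} of in_alg Kv \o j]) /=.
  by rewrite fmorph_eq_rat.
rewrite -rmorphB wE.
apply: le_trans (normc_ge_normIm _).
by rewrite rmorphB embedding_rat; case: (sigma t) => a b /=; rewrite oppr0 addr0.
Qed.

(** [xget] returns a member of a nonempty set, so one witness is enough; the lower bounds above hold
    for every local degree, hence for this value. *)
Lemma local_degree_embedding : is_local_degree v (local_degree v).
Proof.
apply: (@xgetPex _ _ [set n | is_local_degree v n]%classic).
case: (EM (exists t, complex.Im (sigma t) != 0)) => [[t t0]|sR].
  by exists 2%N; exact: (complex_local_degree t0).
exists 1%N; apply: real_local_degree => y.
by apply/eqP/negPn/negP => y0; apply: sR; exists y.
Qed.

Lemma local_degree_gt0 : (0 < local_degree v)%N.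
Proof. exact: is_local_degree_gt0 local_degree_embedding. Qed.

Lemma local_degree_gt1 (t : K) : complex.Im (sigma t) != 0 ->
  (1 < local_degree v)%N.
Proof. by move/is_local_degree_gt1; apply; exact: local_degree_embedding. Qed.

End EmbeddingPlace.

(** * Finiteness of the archimedean places *)

Section AbsoluteValue.
Variables (R : realType) (F : fieldType) (v : F -> R).
Hypothesis vP : is_absolute_value v.

Lemma absv0 : v 0 = 0. Proof. exact/(absv_eq0 vP). Qed.

Lemma absv_gt0 x : (0 < v x) = (x != 0).
Proof.
rewrite lt0r (absv_ge0 vP) andbT; congr (~~ _).
by apply/eqP/eqP => [/(absv_eq0 vP)|->]; rewrite ?absv0.
Qed.

Lemma absv1 : v 1 = 1.
Proof.
have v1 : v 1 != 0 by rewrite gt_eqF // absv_gt0 oner_neq0.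
by apply: (mulfI v1); rewrite -(absvM vP) !mulr1.
Qed.

Lemma absvX x n : v (x ^+ n) = v x ^+ n.
Proof. by elim: n => [|n IHn]; rewrite ?absv1 // !exprS (absvM vP) IHn. Qed.

Lemma absvV x : v x^-1 = (v x)^-1.
Proof.
have [->|x0] := eqVneq x 0; first by rewrite !(invr0, absv0).
have vx : v x != 0 by rewrite gt_eqF // absv_gt0.
by apply: (mulfI vx); rewrite -(absvM vP) !divff // absv1.
Qed.

Lemma absvN x : v (- x) = v x.
Proof.
apply/eqP; rewrite -(@eqrXn2 _ 2) ?(absv_ge0 vP) //.
by rewrite -!absvX sqrrN.
Qed.

Lemma absv_sum_le (I : Type) (r : seq I) (P : pred I) (E : I -> F) :
  v (\sum_(i <- r | P i) E i) <= \sum_(i <- r | P i) v (E i).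
Proof.
elim/big_rec2: _ => [|i y x _ h]; first by rewrite absv0.
by apply: le_trans (absv_triangle vP _ _) _; rewrite lerD2l.
Qed.

Lemma absv_ge_sub x y : v x - v y <= v (x + y).
Proof.
have := absv_triangle vP (x + y) (- y); rewrite addrK absvN; lra.
Qed.

End AbsoluteValue.

(** * Growth and decay of powers of real numbers *)

Lemma expr_unbounded (R : realType) (a B : R) : 1 < a ->
  exists N, forall k, (N <= k)%N -> B < a ^+ k.
Proof.
move=> a1.
have bernoulli k : 1 + (a - 1) *+ k <= a ^+ k.
  elim: k => [|k IHk]; first by rewrite mulr0n addr0.
  rewrite exprS mulrSr.
  have : 0 <= (a - 1) *+ k by rewrite mulrn_wge0 // subr_ge0 ltW.
  by move: IHk; set u := _ *+ k; set w := a ^+ k => h u0; nra.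
have a10 : 0 < a - 1 by rewrite subr_gt0.
exists (Num.truncn (B / (a - 1))).+1 => k Nk.
apply: lt_le_trans (bernoulli k).
have : B / (a - 1) < k%:R.
  by apply: lt_le_trans (truncnS_gt _) _; rewrite ler_nat.
by rewrite ltr_pdivrMr // mulr_natl; lra.
Qed.

Lemma expr_small (R : realType) (a e : R) : 0 <= a -> a < 1 -> 0 < e ->
  exists N, forall k, (N <= k)%N -> a ^+ k < e.
Proof.
rewrite le_eqVlt => /predU1P[<- _ e0|a0 a1 e0].
  by exists 1%N => -[//|k] _; rewrite expr0n.
have [|N hN] := @expr_unbounded R a^-1 e^-1; first by rewrite invf_gt1.
exists N => k /hN; rewrite exprVn ltf_pV2 // posrE; exact: exprn_gt0.
Qed.

Lemma eventually_all (T : eqType) (s : seq T) (P : T -> nat -> Prop) :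
  {in s, forall u, exists N, forall k, (N <= k)%N -> P u k} ->
  exists N, forall k, (N <= k)%N -> {in s, forall u, P u k}.
Proof.
elim: s => [|u s IHs] h; first by exists 0%N.
have [|N1 h1] := IHs; first by move=> w ws; apply: h; rewrite inE ws orbT.
have [N2 h2] := h u (mem_head _ _).
exists (maxn N1 N2) => k; rewrite geq_max => /andP[k1 k2] w.
by rewrite inE => /predU1P[->|]; [exact: h2|exact: h1].
Qed.

Section ArchimedeanPlaces.
Variables (R : realType) (K : fieldExtType rat).
Implicit Types v w : K -> R.

Definition arch_place v : Prop :=
  is_absolute_value v /\ forall q : rat, v q%:A = arch_absv R q.

(** Up to inversion, w x < v x for some x. Dividing x by a rational strictly in between moves the
    gap across 1, because both places restrict to the usual absolute value on Q. *)
Lemma arch_place_separate v w : arch_place v -> arch_place w -> v <> w ->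
  exists x, 1 < v x /\ w x < 1.
Proof.
move=> [va vQ] [wa wQ] vw.
have [x wv] : exists x, w x < v x.
  have [x vwx] : exists x, v x <> w x.
    apply: contrapT => h; apply: vw; apply/funext => x.
    by apply: contrapT => e; apply: h; exists x.
  have [h|h|//] := ltgtP (v x) (w x); last by exists x.
  have x0 : x != 0 by apply/eqP => x0; move: h; rewrite x0 (absv0 va) (absv0 wa) ltxx.
  by exists x^-1; rewrite (absvV va) (absvV wa) ltf_pV2 // posrE ?(absv_gt0 va) ?(absv_gt0 wa).
have [q] := @rat_in_itvoo R _ _ wv; rewrite in_itv /= => /andP[q1 q2].
have q0 : 0 < ratr q :> R := le_lt_trans (absv_ge0 wa x) q1.
have aq : arch_absv R q = ratr q by rewrite /arch_absv ratr_norm gtr0_norm.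
exists (x / q%:A); rewrite (absvM va) (absvM wa) (absvV va) (absvV wa) vQ wQ aq.
by rewrite ltr_pdivlMr // ltr_pdivrMr // !mul1r.
Qed.

(* Let y separate v from all of s but w, and let z separate v from w. For k
   large, z y^k works if w y <= 1, and z y^k / (1 + y^k) otherwise. *)
Lemma arch_place_separate_all v (s : seq (K -> R)) : arch_place v ->
  {in s, forall w, arch_place w /\ v <> w} ->
  exists x, 1 < v x /\ {in s, forall w, w x < 1}.
Proof.
move=> vP; elim: s => [|w s IHs] sP.
  exists 2%:R; split=> //; case: vP => va vQ.
  have -> : 2%:R = (2%:R : rat)%:A :> K by rewrite scaler_nat.
  rewrite vQ /arch_absv normr_nat ratr_nat.
  by rewrite ltr1n.
have [|y [vy sy]] := IHs; first by move=> u us; apply: sP; rewrite inE us orbT.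
have [wP vw] := sP w (mem_head _ _).
have [z [vz wz]] := arch_place_separate vP wP vw.
have {}sP : {in s, forall u, is_absolute_value u}.
  by move=> u us; have [] := sP u; rewrite ?inE ?us ?orbT // => -[].
case: vP wP => va _ [wa _];
(* With e = 1 this settles the places u of s in both cases: it gives u(z y^k) < 1, and also u(z y^k)
   < 1 - u(y)^k <= u(1 + y^k). *)
have sy0 e : 0 < e -> exists N, forall k, (N <= k)%N ->
    {in s, forall u, u z * u y ^+ k < e * (1 - u y ^+ k)}.
  move=> e0; apply: eventually_all => u us.
  have uz : 0 <= u z by apply/absv_ge0/sP.
  have uze : 0 < u z + e by lra.
  have [|N hN] := @expr_small R (u y) (e / (u z + e)) (absv_ge0 (sP u us) _) (sy u us).
    by rewrite divr_gt0.
  by exists N => k /hN; rewrite ltr_pdivlMr //; lra.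
have [wy|wy] := leP (w y) 1.
  have [N hN] := sy0 1 ltr01.
  exists (z * y ^+ N); split.
    have := exprn_ege1 N (ltW vy); rewrite (absvM va) (absvX va); nra.
  move=> u; rewrite inE => /predU1P[->|us].
    rewrite (absvM wa) (absvX wa); apply: le_lt_trans wz.
    by rewrite ler_piMr ?(absv_ge0 wa) // exprn_ile1 ?(absv_ge0 wa).
  rewrite (absvM (sP u us)) (absvX (sP u us)).
  have := hN N (leqnn _) u us; have := exprn_ge0 N (absv_ge0 (sP u us) y); lra.
have [N1 h1] := sy0 1 ltr01.
have vz1 : 0 < v z - 1 by lra.
have wz1 : 0 < 1 - w z by lra.
have [N2 h2] := @expr_unbounded R (v y) (1 / (v z - 1)) vy.
have [N3 h3] := @expr_unbounded R (w y) (1 / (1 - w z)) wy.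
pose k := (N1 + (N2 + N3)).+1.
have {}h1 := h1 k (leqW (leq_addr _ _)).
have {}h2 := h2 k (leqW (leq_trans (leq_addr _ _) (leq_addl _ _))).
have {}h3 := h3 k (leqW (leq_trans (leq_addl _ _) (leq_addl _ _))).
move: h2 h3; rewrite !ltr_pdivrMr // => h2 h3.
have vk : 1 < v y ^+ k by rewrite exprn_egt1.
have y1 : 1 + y ^+ k != 0.
  rewrite -(absv_gt0 va) addrC.
  have := absv_ge_sub va (y ^+ k) 1; rewrite (absvX va) (absv1 va); lra.
exists (z * (y ^+ k / (1 + y ^+ k))); split.
  rewrite !(absvM va) (absvV va) (absvX va) mulrA ltr_pdivlMr ?(absv_gt0 va) // mul1r.
  have := absv_triangle va 1 (y ^+ k); rewrite (absv1 va) (absvX va); nra.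
move=> u; rewrite inE => /predU1P[->|us].
  rewrite !(absvM wa) (absvV wa) (absvX wa) mulrA ltr_pdivrMr ?(absv_gt0 wa) // mul1r.
  have := absv_ge_sub wa (y ^+ k) 1; rewrite (absv1 wa) (absvX wa) [y ^+ k + 1]addrC; nra.
have ua := sP u us.
rewrite !(absvM ua) (absvV ua) (absvX ua) mulrA ltr_pdivrMr ?(absv_gt0 ua) // mul1r.
have := absv_ge_sub ua 1 (y ^+ k); rewrite (absv1 ua) (absvX ua).
have := h1 u us; lra.
Qed.
End ArchimedeanPlaces.

Section ArchimedeanPlaces.
Variables (R : realType) (K : fieldExtType rat).

(* High powers of elements, each of which is large at one place of s and small
   at the others, are linearly independent over Q. *)
Lemma arch_places_size (s : seq (K -> R)) : uniq s ->
  {in s, forall v, arch_place v} -> (size s <= \dim {: K})%N.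
Proof.
move=> us sP; pose V (i : 'I_(size s)) := nth (fun=> 0) s i.
have Vs i : V i \in s by exact: mem_nth.
have sep i : exists y, 1 < V i y /\ forall j, j != i -> V j y < 1.
  have [|y [y1 y2]] := @arch_place_separate_all R K (V i) (rem (V i) s) (sP _ (Vs i)).
    move=> w; rewrite mem_rem_uniq // inE => /andP[wV ws].
    by split; [exact: sP|move=> e; rewrite e eqxx in wV].
  exists y; split=> // j ji; apply: y2; rewrite mem_rem_uniq // inE Vs andbT.
  by rewrite nth_uniq.
have [y yP] := choice sep.
have [k hk] : exists k, forall i, (size s)%:R < V i (y i ^+ k).
  have [|k hk] := @eventually_all _ (enum 'I_(size s))
      (fun i k => (size s)%:R < V i (y i) ^+ k).
    by move=> i _; apply: expr_unbounded; case: (yP i).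
  exists k => i; have [va _] := sP _ (Vs i).
  by rewrite (absvX va); apply: (hk k (leqnn k)); rewrite mem_enum.
pose z := [tuple y i ^+ k | i < size s].
have zE (i : 'I_(size s)) : z`_i = y i ^+ k by rewrite -tnth_nth tnth_mktuple.
suff fz : free z by rewrite -[leqLHS](size_tuple z) -(eqP fz) dimvS ?subvf.
apply/freeP => c cz i1; apply/eqP/negPn/negP => ci1.
(* At the index i of the largest coefficient, the i-th term exceeds |c i| times the size of s, while
   the other terms are at most |c i| each. *)
case: (@Order.TotalTheory.arg_maxP _ _ _ i1 predT (fun i => `|c i|)) => // i _ imax.
have ci : 0 < `|c i| by apply: lt_le_trans (imax i1 _); rewrite ?normr_gt0.
have [va vQ] := sP _ (Vs i).
have vc j w : V i (c j *: w) = arch_absv R (c j) * V i w.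
  by rewrite -[c j *: w]mulr_algl (absvM va) vQ.
have ac : 0 < arch_absv R (c i) by rewrite /arch_absv ltr0q.
have hi : c i *: z`_i = - \sum_(j < size s | j != i) c j *: z`_j.
  by apply/eqP; rewrite -addr_eq0; move: cz; rewrite (bigD1 i) //= => ->.
have : arch_absv R (c i) * (size s)%:R < V i (c i *: z`_i).
  by rewrite vc ltr_pM2l // zE.
apply/negP; rewrite -leNgt hi (absvN va).
apply: le_trans (absv_sum_le va _ _ _) _.
apply: (@le_trans _ _ (\sum_(j < size s | j != i) arch_absv R (c i))).
  apply: ler_sum => j ji; rewrite vc zE -[leRHS]mulr1.
  apply: ler_pM; rewrite ?(absv_ge0 va) //.
  - by rewrite /arch_absv ler0q.
  - by rewrite /arch_absv ler_rat; exact: imax.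
  - by rewrite (absvX va) exprn_ile1 ?(absv_ge0 va) // ltW // (proj2 (yP j)) // eq_sym.
rewrite sumr_const -[leLHS]mulr_natr ler_pM2l // ler_nat.
by apply: leq_trans (max_card _) _; rewrite card_ord.
Qed.

Lemma finite_arch_places : finite_set [set v : K -> R | arch_place v]%classic.
Proof.
apply: contrapT => inf.
have [B BA] := @infinite_set_fset _ _ (\dim {: K}).+1 inf.
apply/negP; rewrite -leqNgt; apply: arch_places_size => [|v vB].
  exact: fset_uniq.
exact: (BA v).
Qed.

End ArchimedeanPlaces.

(** * Non-archimedean places and the support of the height *)

Lemma padic_absv_int (R : realType) p (z : int) : prime p ->
  padic_absv R p z%:~R <= 1.
Proof.
move=> pp; rewrite /padic_absv; case: ifP => // _.
have p0 : (0 < p%:R ^+ logn p `|z| :> R) by rewrite exprn_gt0 // ltr0n prime_gt0.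
rewrite numq_int denq_int logn1 expr0 ler_pdivrMr // mul1r exprn_ege1 //.
by rewrite ler1n prime_gt0.
Qed.

(* The powers of x are combinations of 1, x, ..., x^(deg f - 1) with integer
   coefficients, hence their absolute values are bounded. *)
Lemma absv_integral_le1 (R : realType) (K : fieldExtType rat) (v : K -> R)
  (f : {poly int}) (x : K) : is_absolute_value v ->
  (forall z : int, v z%:~R <= 1) -> f \is monic ->
  root (map_poly intr f) x -> v x <= 1.
Proof.
move=> va vZ fm fx; rewrite leNgt; apply/negP => vx1.
pose B := \sum_(i < size f) v x ^+ i.
have [k hk] := expr_unbounded B vx1.
have := hk k (leqnn _); apply/negP; rewrite -leNgt -(absvX va).
pose r := Pdiv.Ring.rmodp 'X^k f.
have -> : x ^+ k = (map_poly intr r).[x].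
  have := congr1 (fun p => (map_poly (intr : int -> K) p).[x])
    (Pdiv.RingMonic.rdivp_eq fm 'X^k).
  rewrite rmorphD rmorphM hornerD hornerM (rootP fx) mulr0 add0r.
  by rewrite map_polyXn hornerXn.
have szr : (size r <= size f)%N.
  by rewrite ltnW // Pdiv.Ring.ltn_rmodpN0 ?monic_neq0.
rewrite (horner_coef_wide _ (leq_trans (size_poly _ _) szr)).
apply: le_trans (absv_sum_le va _ _ _) _; apply: ler_sum => i _.
rewrite coef_map_id0 ?rmorph0 // (absvM va) (absvX va).
by rewrite -[leRHS]mul1r ler_wpM2r // exprn_ge0 // (absv_ge0 va).
Qed.

Lemma ln_powR_max0 (R : realType) (a r : R) : 0 <= r -> 
  Num.max (ln (a `^ r)) 0 = r * Num.max (ln a) 0.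
Proof. by move=> r0; rewrite ln_powR maxr_pMr // mulr0. Qed.

(** x is an algebraic integer, so the p-adic places contribute nothing and only the finitely many
    archimedean ones remain. Finiteness matters because a [\sum_(v \in A)] with infinite support is
    0 by convention. *)
Lemma finite_height_support (R : realType) (K : fieldExtType rat)
    (f : {poly int}) (x : K) : f \is monic -> root (map_poly intr f) x ->
  finite_set (@places R K `&`
    [set v | Num.max (ln (normalized_absv v x)) 0 != 0])%classic.
Proof.
move=> fm fx; apply: sub_finite_set (finite_arch_places R K) => v [[va vQ]] /=.
rewrite /normalized_absv ln_powR_max0 ?divr_ge0 ?ler0n // => h.
case: vQ => [vQ|[p pp vQ]]; first by split.
suff vx : v x <= 1 by move: h; rewrite (max_idPr _) ?mulr0 ?eqxx // ln_le0.
apply: absv_integral_le1 va _ fm fx => z.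
by rewrite -[z%:~R]scaler_int; have := padic_absv_int R z pp; rewrite -vQ.
Qed.

(** * Lower bounds for the height *)

Lemma sum_le_fsum (R : numDomainType) (T : choiceType) (A : set T)
    (F : T -> R) (s : seq T) : uniq s -> {in s, forall i, A i} ->
  finite_set (A `&` [set i | F i != 0])%classic -> (forall i, A i -> 0 <= F i) ->
  \sum_(i <- s) F i <= \sum_(i \in A) F i.
Proof.
move=> us sA fin F0; rewrite fsbig_supp.
set B := (A `&` _)%classic.
have BE : B = (A `&` [set i | F i != 0])%classic.
  by apply/seteqP; split=> i [Ai /= /eqP Fi].
have sub : (B `<=` B `|` [set` s])%classic by move=> i; left.
rewrite (fsbig_widen _ (B `|` [set` s])%classic _ sub); last first.
  move=> i [[Bi|si] nB] //=; apply: contrapT => Fi; apply: nB; split=> //; exact: sA.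
rewrite (fsbigID [set` s]%classic); last first.
  by rewrite finite_setU; split; [rewrite BE|exact: finite_seq].
rewrite (_ : (_ `&` [set` s])%classic = [set` s]%classic); last first.
  by apply/seteqP; split=> [i []//|i si]; split=> //; right.
rewrite -fsbig_seq // lerDl; apply: fsumr_ge0 => i [[[Ai _]|si] _]; apply: F0 => //.
exact: sA.
Qed.

(* ln 0 = 0, so that logp 0 = 0. *)
Definition logp (R : realType) (z : R[i]) : R := Num.max (ln (normc z)) 0.

Lemma logp_ge0 (R : realType) (z : R[i]) : 0 <= logp z.
Proof. by rewrite /logp le_max lexx orbT. Qed.

(* K = Q(x), and p is the minimal polynomial of x. *)
Section PrimitiveElement.
Variables (R : realType) (K : fieldExtType rat) (x : K) (p : {poly rat}).
Hypothesis p_monic : p \is monic.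
Hypothesis pP : forall q : {poly rat}, root (map_poly (in_alg K) q) x = (p %| q).
Hypothesis xK : forall y : K, exists q : {poly rat}, y = (map_poly (in_alg K) q).[x].

Local Notation evalC q z := (map_poly (ratr : rat -> R[i]) q).[z].

(** K is Q[X]/(p), since p generates the polynomials vanishing at x. Hence the value at b of a
    polynomial representing y depends on y only, which is [fE]. *)
Lemma exists_embedding (b : R[i]) : root (map_poly ratr p) b ->
  exists sigma : {rmorphism K -> R[i]}, sigma x = b.
Proof.
move=> pb; have [q qE] := choice xK.
pose f y := evalC (q y) b.
have fE (r : {poly rat}) y : y = (map_poly (in_alg K) r).[x] -> f y = evalC r b.
  move=> yE; apply/eqP; rewrite -subr_eq0 -hornerN -hornerD -rmorphB.
  have : p %| q y - r by rewrite -pP rmorphB /root hornerD hornerN -qE -yE subrr.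
  by case/dvdpP => s ->; rewrite rmorphM hornerM (rootP pb) mulr0.
have fB : zmod_morphism f.
  move=> y z; rewrite (fE (q y - q z)); last by rewrite rmorphB hornerD hornerN -!qE.
  by rewrite rmorphB hornerD hornerN.
have fM : monoid_morphism f.
  split=> [|y z].
    by rewrite (fE 1) ?rmorph1 ?hornerC.
  rewrite (fE (q y * q z)); last by rewrite rmorphM hornerM -!qE.
  by rewrite rmorphM hornerM.
pose fa := GRing.isZmodMorphism.Build K R[i] f fB.
pose fm := GRing.isMonoidMorphism.Build K R[i] f fM.
exists (HB.pack_for {rmorphism K -> R[i]} f fa fm) => /=.
by rewrite (fE 'X) ?map_polyX ?hornerX.
Qed.

Lemma dim_primitive : (\dim {: K} <= (size p).-1)%N.
Proof.
pose X := [tuple x ^+ i | i < (size p).-1].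
suff <- : <<X>>%VS = fullv by rewrite -[leqRHS](size_tuple X) dim_span.
apply/eqP; rewrite eqEsubv subvf; apply/subvP => y _.
have p0 := monic_neq0 p_monic.
have [q ->] := xK y.
rewrite (divp_eq q p) rmorphD rmorphM hornerD hornerM.
have /rootP -> : root (map_poly (in_alg K) p) x by rewrite pP dvdpp.
rewrite mulr0 add0r (@horner_coef_wide _ (size p).-1); last first.
  rewrite size_map_poly -ltnS prednK ?size_poly_gt0 //.
  by rewrite ltn_modp.
apply: memv_suml => i _; rewrite coef_map mulr_algl memvZ //.
by rewrite memv_span // (_ : x ^+ i = tnth X i) ?mem_tnth // tnth_mktuple.
Qed.

Lemma primitive_irreducible : (1 < size p)%N -> irreducible_poly p.
Proof.
have p0 := monic_neq0 p_monic.
move=> sp; split=> // q sq /dvdpP[r pE].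
have r0 : r != 0 by apply: contraNneq p0 => r0; rewrite pE r0 mul0r.
have q0 : q != 0 by apply: contraNneq p0 => q0; rewrite pE q0 mulr0.
have : root (map_poly (in_alg K) (r * q)) x by rewrite pP -pE.
rewrite rmorphM rootM !pP => /orP[/(dvdp_leq r0) pr|pq].
  have := size_mul r0 q0; rewrite -pE => sE.
  have := size_poly_gt0 q; rewrite q0; move: pr sq; rewrite sE.
  by case: (size q) => [|[|k]] //; rewrite !addnS /= ltnNge leq_addr.
by rewrite /eqp pq pE dvdp_mulIr.
Qed.

Lemma primitive_separable (rs : seq R[i]) : (1 < size p)%N ->
  map_poly ratr p = \prod_(b <- rs) ('X - b%:P) -> uniq rs.
Proof.
move=> sp pE; rewrite -separable_prod_XsubC -pE separable_map.
rewrite unlock irreducible_poly_coprime; last exact: primitive_irreducible.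
have p0 := monic_neq0 p_monic.
have d0 : p^`() != 0.
  apply/eqP => d0; have := coef_deriv p (size p).-2; rewrite d0 coef0.
  case E: (size p) sp => [|[|k]] // _ /=; have /monicP := p_monic.
  by rewrite lead_coefE E /= => -> /eqP; rewrite eq_sym pnatr_eq0.
apply/negP => /(dvdp_leq d0); rewrite leqNgt => /negP; apply.
exact: lt_size_deriv.
Qed.

(** The distances from z to 0 and to 1 determine z up to conjugation, and the sign of the imaginary
    part removes the ambiguity; hence the evaluation at x and x - 1. *)
Lemma embedding_absv_inj (sigma tau : {rmorphism K -> R[i]}) :
  0 <= complex.Im (sigma x) -> 0 <= complex.Im (tau x) ->
  embedding_absv sigma = embedding_absv tau -> sigma x = tau x.
Proof.
move=> is0 it0 /(congr1 (fun v => (v x, v (x - 1)))) [].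
rewrite /embedding_absv !rmorphB !rmorph1.
case: (sigma x) (tau x) is0 it0 => a b [c d] /= b0 d0.
have sq (u w : R) : 0 <= u -> 0 <= w -> Num.sqrt u = Num.sqrt w -> u = w.
  by move=> u0 w0 h; rewrite -(sqr_sqrtr u0) h sqr_sqrtr.
move=> /sq e1 /sq e2.
have {}e1 : a ^+ 2 + b ^+ 2 = c ^+ 2 + d ^+ 2 by apply: e1; rewrite addr_ge0 ?sqr_ge0.
have {}e2 : (a - 1) ^+ 2 + (b - 0) ^+ 2 = (c - 1) ^+ 2 + (d - 0) ^+ 2.
  by apply: e2; rewrite addr_ge0 ?sqr_ge0.
have ac : a = c by nra.
have : b ^+ 2 = d ^+ 2 by move: e1; rewrite ac => /addrI.
by move/eqP; rewrite eqrXn2 // ac => /eqP ->.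
Qed.

End PrimitiveElement.

(** * Pairing of complex conjugate roots *)

Section ConjugateSum.
Variable R : realType.

Lemma Im_conjc (b : R[i]) : complex.Im (conjc b) = - complex.Im b.
Proof. by case: b. Qed.

Lemma logp_conjc (b : R[i]) : logp (conjc b) = logp b.
Proof. by case: b => a b; rewrite /logp /= sqrrN. Qed.

Lemma perm_conjc_roots (p : {poly rat}) (rs : seq R[i]) : uniq rs ->
  map_poly ratr p = \prod_(b <- rs) ('X - b%:P) ->
  perm_eq rs [seq conjc b | b <- rs].
Proof.
move=> us pE.
have mem_rs b : (b \in rs) = root (map_poly ratr p) b.
  by rewrite pE root_prod_XsubC.
have conj_rs b : (conjc b \in rs) = (b \in rs).
  rewrite !mem_rs -complex_root_conj -map_poly_comp; congr (root _ b).
  apply: eq_map_poly => q.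
  by rewrite -(fmorph_eq_rat [the {rmorphism rat -> R[i]} of conjc \o ratr]).
apply: uniq_perm => //; first by rewrite map_inj_uniq //; exact/inv_inj/conjcK.
by move=> b; rewrite -[b in RHS]conjcK (mem_map (inv_inj (@conjcK R))) conj_rs.
Qed.

(** The roots below the real axis are folded onto their conjugates. The resulting weights, 1 for
    real and 2 for nonreal roots, match the local degrees. *)
Lemma sum_logp_roots (p : {poly rat}) (rs : seq R[i]) : uniq rs ->
  map_poly ratr p = \prod_(b <- rs) ('X - b%:P) ->
  \sum_(b <- rs) logp b =
  \sum_(b <- rs | 0 <= complex.Im b) (1 + (complex.Im b != 0)%:R) * logp b.
Proof.
move=> us pE.
rewrite (bigID (fun b : R[i] => 0 <= complex.Im b)) /=.
rewrite [X in _ + X](perm_big _ (perm_conjc_roots us pE)) big_map /=.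
rewrite [X in _ + X](eq_bigl (fun b : R[i] => 0 < complex.Im b)); last first.
  by move=> b; rewrite Im_conjc oppr_ge0 -ltNge.
have -> : \sum_(b <- rs | 0 < complex.Im b) logp (conjc b) =
    \sum_(b <- rs | 0 <= complex.Im b) (complex.Im b != 0)%:R * logp b.
  rewrite [RHS](bigID (fun b : R[i] => complex.Im b == 0)) /=.
  rewrite [X in _ = X + _]big1 ?add0r => [|b /= /andP[_ ->]]; last by rewrite mul0r.
  rewrite (eq_bigl (fun b : R[i] => (0 <= complex.Im b) && (complex.Im b != 0))).
    by apply: eq_bigr => b /= /andP[_ ->]; rewrite mul1r logp_conjc.
  by move=> b; rewrite lt0r andbC.
by rewrite -big_split; apply: eq_bigr => b _; rewrite mulrDl mul1r.
Qed.

End ConjugateSum.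

Section Height.
Variables (R : realType) (K : fieldExtType rat) (x : K) (p : {poly rat}).
Hypothesis p_monic : p \is monic.
Hypothesis pP : forall q : {poly rat}, root (map_poly (in_alg K) q) x = (p %| q).
Hypothesis xK : forall y : K, exists q : {poly rat}, y = (map_poly (in_alg K) q).[x].

(** Each root in the closed upper half-plane gives a place, and these are distinct. The local degree
    is at least the weight of the root in [sum_logp_roots], and the factor [K:Q] cancels the
    normalization. *)
Lemma nf_height_ge (f : {poly int}) (rs : seq R[i]) :
  f \is monic -> root (map_poly intr f) x -> (1 < size p)%N ->
  map_poly ratr p = \prod_(b <- rs) ('X - b%:P) ->
  \sum_(b <- rs) logp b <= (size p).-1%:R * nf_height R x.
Proof.
move=> fm fx sp pE.
have us := primitive_separable p_monic pP sp pE.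
have rs_root b : b \in rs -> root (map_poly ratr p) b.
  by rewrite pE root_prod_XsubC.
(* [choice] needs an embedding for every complex number; [s0] is the dummy value off [rs], and it
   exists as p is not constant. *)
have [s0 _] : exists sigma : {rmorphism K -> R[i]}, True.
  have : (1 < size (map_poly (ratr : rat -> R[i]) p))%N by rewrite size_map_poly.
  rewrite {1}pE size_prod_XsubC.
  case: rs {pE us} rs_root => [|b s] //= /(_ b (mem_head _ _)) pb _.
  by have [sigma _] := exists_embedding pP xK pb; exists sigma.
have [|S SE] := @choice _ _ (fun b (sigma : {rmorphism K -> R[i]}) =>
    b \in rs -> sigma x = b).
  move=> b; case: (boolP (b \in rs)) => [/rs_root|_]; last by exists s0.
  by case/(exists_embedding pP xK) => sigma; exists sigma.
pose F (v : K -> R) := Num.max (ln (normalized_absv v x)) 0.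
have F0 v : 0 <= F v by rewrite /F le_max lexx orbT.
have h0 : 0 <= nf_height R x by apply: fsumr_ge0 => v _; exact: F0.
have d0 : 0 < (\dim {: K})%:R :> R by rewrite ltr0n adim_gt0.
suff : \sum_(b <- rs) logp b <= (\dim {: K})%:R * nf_height R x.
  move/le_trans; apply; rewrite ler_wpM2r // ler_nat.
  exact: dim_primitive p_monic pP xK.
pose T := [seq b <- rs | 0 <= complex.Im b].
pose vs := [seq embedding_absv (S b) | b <- T].
have vsP : {in vs, forall v, places v}.
  by move=> v /mapP[b _ ->]; exact: embedding_place.
have uvs : uniq vs.
  rewrite map_inj_in_uniq ?filter_uniq // => b c.
  rewrite !mem_filter => /andP[b0 brs] /andP[c0 crs] h.
  by rewrite -(SE b) // -(SE c) //; apply: embedding_absv_inj h; rewrite SE.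
have := sum_le_fsum uvs vsP (finite_height_support R fm fx) (fun v _ => F0 v).
rewrite -/(nf_height R x) -(ler_pM2l d0); apply: le_trans.
rewrite (sum_logp_roots us pE) /vs big_map /T big_filter mulr_sumr.
rewrite big_seq_cond [leRHS]big_seq_cond; apply: ler_sum => b /andP[brs b0].
rewrite /F /normalized_absv ln_powR_max0 ?divr_ge0 ?ler0n //.
rewrite {2}/embedding_absv SE // -/(logp b) [leRHS](mulrA) [_ * (_ / _)]mulrC.
rewrite divfK ?(gt_eqF d0) // ler_wpM2r ?logp_ge0 //.
rewrite [leLHS](_ : _ = (1 + (complex.Im b != 0))%:R) ?ler_nat; last by rewrite natrD.
case: eqVneq => [_|bi]; first exact: local_degree_gt0.
by apply: (@local_degree_gt1 _ _ _ x); rewrite SE.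
Qed.

End Height.

(** * Minimal polynomials over Q and sums over all roots *)

Definition rat_minpoly (a : algC) (p : {poly rat}) : Prop :=
  p \is monic /\ forall q : {poly rat}, root (map_poly ratr q) a = (p %| q).

Lemma rat_minpoly_exists a : exists p, rat_minpoly a p.
Proof. by have [p [_ mp pP]] := minCpolyP a; exists p. Qed.

Lemma rat_minpoly_size a p : rat_minpoly a p -> (1 < size p)%N.
Proof.
move=> [mp pP]; have := dvdpp p; rewrite -pP => pa; rewrite ltnNge; apply/negP.
move/size1_polyC => pE; move: pa mp; rewrite pE map_polyC rootC fmorph_eq0 => /eqP->.
by rewrite monicE lead_coefC eq_sym oner_eq0.
Qed.

(** The minimal polynomial r of b divides p = s r. As a is a root of s or of r, p divides one of
    them; s is excluded by its degree, so p = r. *)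
Lemma rat_minpoly_conj a b p : rat_minpoly a p -> root (map_poly ratr p) b ->
  rat_minpoly b p.
Proof.
move=> [mp pP] pb; split=> // q.
have [r [mr rP]] := rat_minpoly_exists b.
have /dvdpP[s pE] : r %| p by rewrite -rP.
have rb : root (map_poly ratr r) b by rewrite rP.
have p0 := monic_neq0 mp.
have s0 : s != 0 by apply: contraNneq p0 => s0; rewrite pE s0 mul0r.
rewrite rP; suff -> : p = r by [].
apply/eqP; rewrite -eqp_monic // /eqp {2}pE dvdp_mull // andbT.
have : root (map_poly ratr (s * r)) a by rewrite -pE pP.
rewrite rmorphM rootM !pP => /orP[/(dvdp_leq s0)|//].
have r0 := monic_neq0 mr.
have := rat_minpoly_size (conj mr rP).
rewrite {1}pE size_mul //; case: (size r) => [|[|k]] // _.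
by rewrite !addnS /= ltnNge leq_addr.
Qed.

Section RootSums.
Variable R : realType.

(** [num_field_exists] presents Q(a) with a generator x sent to a. Since the embedding into [algC]
    is injective, the relations of a over Q pass to x. *)
Lemma weil_height_ge (f : {poly int}) (a : algC) (p : {poly rat})
    (rs : seq R[i]) : f \is monic -> root (alg_poly f) a -> rat_minpoly a p ->
  map_poly ratr p = \prod_(b <- rs) ('X - b%:P) ->
  \sum_(b <- rs) logp b <= (size p).-1%:R * weil_height R a.
Proof.
move=> fm fa pP pE; rewrite /weil_height.
case: num_field_exists => K [QnC [[|x [|//]] //= [xa] gen]].
have [mp pP'] := pP.
apply: (nf_height_ge mp _ _ fm _ (rat_minpoly_size pP) pE).
- move=> q; rewrite -pP' -(fmorph_root QnC) xa -map_poly_comp; congr (root _ a).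
  by apply: eq_map_poly => c; rewrite /= alg_num_field fmorph_rat.
- move=> y; have : y \in <<1; x>>%VS by rewrite -adjoin_seq1 gen memvf.
  by case/Fadjoin_polyP => q /polyOver1P[r ->] ->; exists r.
- rewrite -(fmorph_root QnC) xa -map_poly_comp.
  suff -> : map_poly (QnC \o intr) f = alg_poly f by [].
  by apply: eq_map_poly => c; rewrite /= rmorph_int.
Qed.

(** Induction on the degree, splitting off the minimal polynomial p of one root. [A] and [B] lie in
    different fields and are linked through factorizations over Q. *)
Lemma sum_logp_le_heights (H : algC -> R) (P : {poly rat}) (A : seq algC)
    (B : seq R[i]) :
  map_poly ratr P = \prod_(a <- A) ('X - a%:P) ->
  map_poly ratr P = \prod_(b <- B) ('X - b%:P) ->
  (forall a p rs, a \in A -> rat_minpoly a p ->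
    map_poly ratr p = \prod_(b <- rs) ('X - b%:P) ->
    \sum_(b <- rs) logp b <= (size p).-1%:R * H a) ->
  \sum_(b <- B) logp b <= \sum_(a <- A) H a.
Proof.
have [n] := ubnP (size A); elim: n => // n IHn in P A B *.
rewrite ltnS => sA PA PB hA.
have sAB : size A = size B.
  apply/eq_add_S; rewrite -(size_prod_XsubC _ id) -(size_prod_XsubC B id) -PA -PB.
  by rewrite !size_map_poly.
have Pm : P \is monic.
  by rewrite -(map_monic (ratr : {rmorphism rat -> algC})) PA monic_prod_XsubC.
case EA: A => [|a A0].
  by move: sAB; rewrite EA; case: (B) => // _; rewrite !big_nil.
have [p pP] := rat_minpoly_exists a.
have aA : a \in A by rewrite EA mem_head.
have [mp pdvd] := pP.
have /dvdpP[Q PE] : p %| P by rewrite -pdvd PA root_prod_XsubC.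
have mQ : Q \is monic by rewrite -(monicMr Q mp) -PE.
have split_poly (F : closedFieldType) (g : {rmorphism rat -> F}) (q : {poly rat}) :
    q \is monic -> exists r, map_poly g q = \prod_(b <- r) ('X - b%:P).
  move=> mq; have [r rE] := closed_field_poly_normal (map_poly g q).
  by exists r; rewrite {1}rE lead_coef_map (monicP mq) rmorph1 scale1r.
have [A1 pA1] := split_poly _ (ratr : {rmorphism rat -> algC}) p mp.
have [A2 QA2] := split_poly _ (ratr : {rmorphism rat -> algC}) Q mQ.
have [B1 pB1] := split_poly _ (ratr : {rmorphism rat -> R[i]}) p mp.
have [B2 QB2] := split_poly _ (ratr : {rmorphism rat -> R[i]}) Q mQ.
have permA : perm_eq A (A2 ++ A1).
  by apply: prod_XsubC_eq; rewrite -PA PE rmorphM /= QA2 pA1 big_cat.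
have permB : perm_eq B (B2 ++ B1).
  by apply: prod_XsubC_eq; rewrite -PB PE rmorphM /= QB2 pB1 big_cat.
have sA1 : size A1 = (size p).-1.
  by rewrite -(size_map_poly (ratr : {rmorphism rat -> algC}) p) pA1 size_prod_XsubC.
rewrite -EA (perm_big _ permA) (perm_big _ permB) !big_cat /=; apply: lerD.
  apply: (IHn Q) => //.
    apply: leq_trans sA; rewrite (perm_size permA) size_cat sA1 -addn1 leq_add2l.
    by have := rat_minpoly_size pP; case: (size p) => [|[|]].
  by move=> b q rs bA2; apply: hA; rewrite (perm_mem permA) mem_cat bA2.
have h b : b \in A1 -> \sum_(c <- B1) logp c <= (size p).-1%:R * H b.
  move=> bA1; apply: hA pB1; first by rewrite (perm_mem permA) mem_cat bA1 orbT.
  by apply: rat_minpoly_conj pP _; rewrite pA1 root_prod_XsubC.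
have p0 : 0 < (size p).-1%:R :> R.
  by rewrite ltr0n; have := rat_minpoly_size pP; case: (size p) => [|[|]].
(* All deg p roots in [A1] have minimal polynomial p, so each satisfies the inequality [h] with the
   same left side; adding these and cancelling deg p gives the claim. *)
rewrite -(ler_pM2l p0) [leRHS]mulr_sumr.
have -> : (size p).-1%:R * \sum_(c <- B1) logp c = \sum_(b <- A1) \sum_(c <- B1) logp c.
  by rewrite [RHS]big_const_seq count_predT iter_addr_0 sA1 mulr_natl.
rewrite big_seq [leRHS]big_seq; exact: ler_sum.
Qed.

Lemma root_height_sum_ge (f : {poly int}) (B : seq R[i]) : f \is monic ->
  map_poly intr f = \prod_(b <- B) ('X - b%:P) ->
  \sum_(b <- B) logp b <= root_height_sum R f.
Proof.
move=> fm fB; rewrite /root_height_sum /alg_roots.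
case: closed_field_poly_normal => A /= fA.
have {}fA : alg_poly f = \prod_(a <- A) ('X - a%:P).
  rewrite {1}fA /alg_poly lead_coef_map_inj ?(monicP fm) ?scale1r //; exact: intr_inj.
pose P : {poly rat} := map_poly intr f.
apply: (@sum_logp_le_heights _ P).
- by rewrite -map_poly_comp -fA; apply: eq_map_poly => c; rewrite /= ratr_int.
- by rewrite -map_poly_comp -fB; apply: eq_map_poly => c; rewrite /= ratr_int.
- move=> a p rs aA; apply: weil_height_ge fm _; rewrite fA root_prod_XsubC //.
Qed.

End RootSums.

(** * Resultants *)

Lemma monic_char_poly (A : comNzRingType) (h : {poly A}) : h \is monic ->
  (1 < size h)%N -> exists n (M : 'M[A]_n.+1),
    char_poly M = h /\ n.+1 = (size h).-1.
Proof.
move=> mh sh; have [d dE] : exists d, d = (size h).-1 by exists (size h).-1.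
have : exists M : 'M[A]_d, char_poly M = h.
  by rewrite dE; exists (companionmx h); exact: companionmxK.
case: d dE => [|d] dE [M ME]; last by exists d, M.
by case: (size h) sh dE => [|[|]].
Qed.

Lemma char_poly_eval (A : comNzRingType) n (M : 'M[A]_n) (b : A) :
  (char_poly M).[b] = \det (b%:M - M).
Proof.
rewrite -horner_evalE /char_poly -det_map_mx; congr (\det _).
apply/matrixP => i j; rewrite !mxE [LHS]horner_evalE.
by rewrite hornerD hornerN hornerMn hornerX hornerC.
Qed.

(** f(M) is the product of the M - b, and det(M - b) is, up to sign, the characteristic polynomial
    at b; so this is a resultant up to sign. *)
Lemma det_horner_mx_roots (A : comNzRingType) n (M : 'M[A]_n.+1) (rs : seq A) :
  \det (horner_mx M (\prod_(b <- rs) ('X - b%:P))) =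
  \prod_(b <- rs) ((-1) ^+ n.+1 * (char_poly M).[b]).
Proof.
rewrite rmorph_prod /=.
rewrite (big_morph (fun B : 'M[A]_n.+1 => \det B) (@det_mulmx _ _) (det1 _ _)).
apply: eq_bigr => b _.
by rewrite rmorphB /= horner_mx_X horner_mx_C -opprB -scaleN1r detZ char_poly_eval.
Qed.

Section Resultant.
Variable R : realType.

(* Up to sign the product is the determinant of f evaluated at the companion
   matrix of h, which equals m g there by Cayley-Hamilton. *)
Lemma prod_norm_roots_ge (f h q g : {poly int}) (m : nat) (rs : seq R[i]) :
  map_poly intr f = \prod_(b <- rs) ('X - b%:P) ->
  h \is monic -> (1 < size h)%N -> f = q * h + m%:R *: g ->
  (forall b, b \in rs -> ~~ root (map_poly intr h) b) ->
  m%:R ^+ (size h).-1 <= \prod_(b <- rs) normc (map_poly intr h).[b].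
Proof.
move=> fE mh sh fqg h0.
have [n [M [Mh <-]]] := monic_char_poly mh sh.
have normc_sign (k : nat) (z : R[i]) : normc ((-1) ^+ k * z) = normc z.
  rewrite ComplexField.Normc.normcM (absvX (normc_absv R)) (absvN (normc_absv R)).
  by rewrite ComplexField.Normc.normc1 expr1n mul1r.
have detE : normc ((\det (horner_mx M f))%:~R : R[i]) =
    \prod_(b <- rs) normc (map_poly intr h).[b].
  rewrite -det_map_mx map_horner_mx fE det_horner_mx_roots -map_char_poly Mh.
  rewrite (big_morph _ (@ComplexField.Normc.normcM R) (@ComplexField.Normc.normc1 R)).
  by apply: eq_bigr => b _; rewrite normc_sign.
have normc_int (z : int) : normc (z%:~R : R[i]) = `|z|%:~R.
  by rewrite -(rmorph_int (real_complex R)) normc_real intr_norm.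
have det0 : \det (horner_mx M f) != 0.
  rewrite -(intr_eq0 R[i]) -(absv_gt0 (normc_absv R)) detE big_seq.
  by apply: prodr_gt0 => b /h0; rewrite (absv_gt0 (normc_absv R)) rootE.
move: det0; rewrite -detE normc_int fqg rmorphD rmorphM /=.
have -> : horner_mx M h = 0 by rewrite -Mh Cayley_Hamilton.
rewrite mulr0 add0r linearZ /= detZ => det0.
rewrite normrM intrM normrX normr_nat; set d := \det _ in det0 *.
rewrite rmorphXn /= rmorph_nat -[leLHS]mulr1 ler_wpM2l //.
  by rewrite exprn_ge0 // ler0z.
by rewrite ler1z -gtz0_ge1 normr_gt0; move: det0; rewrite mulf_eq0 => /norP[].
Qed.

End Resultant.

Lemma intr_Zp_eq0 (m : nat) (z : int) : (1 < m)%N -> z%:~R = 0 :> 'Z_m ->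
  (m%:Z %| z)%Z.
Proof.
move=> m1 z0; rewrite dvdzE /=.
have : (`|z|%N)%:R = 0 :> 'Z_m.
  by case: z z0 => k //; rewrite NegzE rmorphN /= => /eqP; rewrite oppr_eq0 => /eqP.
by move/(congr1 (@nat_of_ord _)); rewrite val_Zp_nat // => /eqP.
Qed.

(** The quotient is lifted to coefficients in [0, m); the difference f - q' h then vanishes modulo m
    and is divided by m coefficientwise. *)
Lemma divides_mod_lift (m : nat) (h f : {poly int}) : (1 < m)%N ->
  divides_mod m h f -> exists q g, f = q * h + m%:R *: g.
Proof.
move=> m1 [q qE]; pose q' : {poly int} := map_poly (fun z : 'Z_m => (z : nat)%:Z) q.
have q'E : map_poly intr q' = q.
  by apply/polyP => i; rewrite !coef_map_id0 //; exact: natr_Zp.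
exists q', (\poly_(i < size (f - q' * h)) ((f - q' * h)`_i %/ m%:Z)%Z).
apply/polyP => i; rewrite coefD coefZ coef_poly.
apply/eqP; rewrite addrC -subr_eq -coefB; apply/eqP.
have /intr_Zp_eq0 d : ((f - q' * h)`_i)%:~R = 0 :> 'Z_m.
  have := coef_map_id0 (f - q' * h) i (rmorph0 (intr : int -> 'Z_m)).
  by rewrite rmorphB rmorphM /= q'E qE subrr coef0.
case: ltnP => [_|si]; last by rewrite mulr0 nth_default.
by rewrite natz [RHS]mulrC divzK ?d.
Qed.

(** * Vandermonde products *)

Lemma norm_det_le (C : numDomainType) n (A : 'M[C]_n) :
  (forall i j, `|A i j| <= 1) -> `|\det A| <= n`!%:R.
Proof.
move=> A1; apply: le_trans (ler_norm_sum _ _ _) _.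
rewrite -card_Sn -sum1_card natr_sum; apply: ler_sum => s _.
rewrite normrM normrX normrN1 expr1n mul1r normr_prod.
by apply: prodr_ile1 => i _; rewrite normr_ge0 A1.
Qed.

Lemma big_triangle (T : Type) (idx : T) (op : Monoid.com_law idx) n
    (F : nat -> nat -> T) :
  \big[op/idx]_(i < n) \big[op/idx]_(j < n | (i < j)%N) F i j =
  \big[op/idx]_(j < n) \big[op/idx]_(i < j) F i j.
Proof.
rewrite (exchange_big_dep predT) //=; apply: eq_bigr => j _.
by rewrite (big_ord_widen_cond n predT (fun i => F i j)) // ltnW.
Qed.

Section Vandermonde.
Variable C : numClosedFieldType.

(** This is the product of (1 - w^k)^(n-k) over 0 < k < n and, up to sign and a power of w, the
    Vandermonde product of 1, w, ..., w^(n-1). *)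
Definition diff_prod (n : nat) (w : C) : C :=
  \prod_(j < n) \prod_(i < j) (1 - w ^+ (j - i)).

(* With w = s^2, u = 1/w and D = diag(s^(i^2)), the product is the determinant of
   D *m Vandermonde(u^0, ..., u^(n-1)) *m D, whose entries s^((i-j)^2) have
   norm at most 1. *)
Lemma norm_diff_prod_le1 n w : `|w| <= 1 -> `|diff_prod n w| <= n`!%:R.
Proof.
move=> w1; have [->|w0] := eqVneq w 0.
  rewrite /diff_prod big1 ?normr1 ?ler1n ?fact_gt0 // => j _.
  by rewrite big1 // => i _; rewrite expr0n subn_eq0 leqNgt ltn_ord subr0.
pose s := sqrtC w; have sE : s ^+ 2 = w by rewrite sqrtCK.
have s0 : s != 0 by rewrite sqrtC_eq0.
have s1 : `|s| <= 1 by rewrite -(@expr_le1 _ 2) // -normrX sE.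
pose u : 'rV[C]_n := \row_i w^-1 ^+ i.
pose D : 'rV[C]_n := \row_i s ^+ (i ^ 2).
pose A := diag_mx D *m Vandermonde n u *m diag_mx D.
suff -> : diff_prod n w = \det A.
  apply: norm_det_le => i j.
  rewrite /A mul_mx_diag mul_diag_mx !mxE -exprM exprVn -sE -exprM.
  have ij : (2 * (j * i) <= i ^ 2 + j ^ 2)%N.
    by have [h _] := nat_Cauchy j i; rewrite addnC.
  rewrite mulrAC -exprD -(subnK ij) exprD mulfK ?expf_neq0 //.
  by rewrite normrX exprn_ile1.
(* The exponents 2 j^2 of s give w^(j^2), that is one factor w^j for each i < j; it turns w^(-j) -
   w^(-i) into 1 - w^(j-i). *)
have DD : (\prod_i D 0 i) * (\prod_i D 0 i) = \prod_(j < n) \prod_(i < j) w ^+ j.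
  rewrite -big_split; apply: eq_bigr => j _.
  by rewrite /= mxE prodr_const card_ord -exprM -sE -exprM -exprD; congr (s ^+ _); lia.
rewrite !det_mulmx !det_diag det_Vandermonde mulrAC DD.
under [X in _ = _ * X]eq_bigr do under eq_bigr do rewrite !mxE.
rewrite (big_triangle _ _ (fun i j : nat => w^-1 ^+ j - w^-1 ^+ i)).
rewrite -big_split; apply: eq_bigr => j _; rewrite -big_split; apply: eq_bigr => i _ /=.
rewrite mulrBr !exprVn mulfV ?expf_neq0 //; congr (_ - _).
have -> : w ^+ j = w ^+ (j - i) * w ^+ i by rewrite -exprD subnK // ltnW.
by rewrite mulfK ?expf_neq0.
Qed.

(** The reflection 1 - w^k = -w^k (1 - w^(-k)) reduces to 1/w, and the factors w^k supply the power
    of |w|. *)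
Lemma norm_diff_prod_ge1 n w : 1 <= `|w| ->
  `|diff_prod n w| <= n`!%:R * `|w| ^+ (\sum_(j < n) \sum_(i < j) (j - i)).
Proof.
move=> w1; have w0 : w != 0 by rewrite -normr_gt0 (lt_le_trans ltr01).
have -> : diff_prod n w = \prod_(j < n) \prod_(i < j) (- w ^+ (j - i)) * diff_prod n w^-1.
  rewrite /diff_prod -big_split; apply: eq_bigr => j _.
  rewrite -big_split; apply: eq_bigr => i _ /=.
  by rewrite exprVn mulrBr !mulNr mulfV ?expf_neq0 // mulr1 opprK addrC.
rewrite normrM mulrC ler_pM //.
  by rewrite norm_diff_prod_le1 // normfV invf_le1 // normr_gt0.
rewrite -prodrXr normr_prod ler_prod // => j _; rewrite normr_ge0 /=.
rewrite -prodrXr normr_prod ler_prod // => i _.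
by rewrite normr_ge0 normrN normrX lexx.
Qed.

End Vandermonde.

(** * Lower bound for the Mahler measure *)

(** The hypothesis concerns roots in [algC], the claim roots in another field. Both amount to the
    coprimality of f and X^k - 1 over Q, which is unchanged by field extension. *)
Lemma no_cyclotomic_root_expr (C : numFieldType) (f : {poly int}) (b : C) k :
  no_cyclotomic_root f -> root (map_poly intr f) b -> (0 < k)%N -> b ^+ k != 1.
Proof.
move=> fnc fb k0; apply/eqP => bk.
pose P : {poly rat} := map_poly intr f; pose Q : {poly rat} := 'X^k - 1.
have PE (F : numFieldType) : map_poly intr f = map_poly ratr P :> {poly F}.
  by rewrite -map_poly_comp; apply: eq_map_poly => c; rewrite /= ratr_int.
have QE (F : numFieldType) : map_poly ratr Q = 'X^k - 1 :> {poly F}.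
  by rewrite rmorphB rmorphXn /= map_polyX rmorph1.
have : ~~ coprimep P Q.
  rewrite -(coprimep_map (ratr : {rmorphism rat -> C})) -PE QE.
  apply/negP => /coprimep_root /(_ fb).
  by rewrite hornerD hornerN hornerXn hornerC bk subrr eqxx.
rewrite -(coprimep_map (ratr : {rmorphism rat -> algC})) -PE QE.
move/negP; apply; apply: Pdiv.ClosedField.root_coprimep => a fa.
by apply/negP => ak; apply: (fnc a fa); exists k.
Qed.

Lemma all_ones_polyE n : 'X^(n.+1) - 1 = ('X - 1) * all_ones_poly n.
Proof. by rewrite /all_ones_poly subrX1. Qed.

Lemma all_ones_poly_monic n : all_ones_poly n \is monic.
Proof.
rewrite -(monicMl _ (monicXsubC 1)) polyC1 -all_ones_polyE.
by rewrite -polyC1 monicXnsubC.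
Qed.

Lemma size_all_ones_poly n : size (all_ones_poly n) = n.+1.
Proof.
have := size_Mmonic (monic_neq0 (monicXsubC 1)) (all_ones_poly_monic n).
rewrite polyC1 -all_ones_polyE -polyC1 size_XnsubC // size_XsubC.
by case.
Qed.

Section MahlerMeasure.
Variables (R : realType) (f : {poly int}) (rs : seq R[i]) (m n : nat).
Hypothesis fE : map_poly intr f = \prod_(b <- rs) ('X - b%:P).
Hypothesis f_noncyc : no_cyclotomic_root f.
Hypothesis m_gt1 : (1 < m)%N.
Hypothesis n_gt1 : (1 < n)%N.
Hypothesis f_div : divides_mod m (all_ones_poly n.-1) f.

Lemma root_expr_neq1 b k : b \in rs -> (0 < k)%N -> b ^+ k != 1.
Proof.
move=> brs; apply: no_cyclotomic_root_expr f_noncyc _.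
by rewrite fE root_prod_XsubC.
Qed.

(** X^(nk) - 1 = h2 h1 with h1 the all-ones polynomial. The factor h1 yields m^(n-1); the resultant
    with h2 is a nonzero integer, hence at least 1 in absolute value. *)
Lemma prod_norm_1subX_ge k : (0 < k)%N ->
  m%:R ^+ n.-1 <= \prod_(b <- rs) normc (1 - (b ^+ n) ^+ k).
Proof.
move=> k0; have n0 := ltnW n_gt1.
set h1 := all_ones_poly n.-1.
pose h2 : {poly int} := ('X - 1) * \sum_(j < k) 'X^n ^+ j.
have h12 : h2 * h1 = 'X^(n * k) - 1.
  by rewrite mulrAC -all_ones_polyE prednK // -subrX1 -exprM.
have mh1 : h1 \is monic by exact: all_ones_poly_monic.
have nk0 : (0 < n * k)%N by rewrite muln_gt0 n0.
have mh2 : h2 \is monic by rewrite -(monicMr _ mh1) h12 -polyC1 monicXnsubC.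
have sh1 : size h1 = n by rewrite size_all_ones_poly prednK.
have sh2 : (1 < size h2)%N.
  have := size_Mmonic (monic_neq0 mh2) mh1.
  rewrite h12 -polyC1 size_XnsubC // sh1 => e.
  have : (n <= n * k)%N by rewrite leq_pmulr.
  move: e; move: (n * k)%N n0 => ? ?; lia.
have evalE b : (map_poly intr h2).[b] * (map_poly intr h1).[b] = (b ^+ n) ^+ k - 1 :> R[i].
  by rewrite -hornerM -rmorphM /= h12 rmorphB rmorphXn /= map_polyX rmorph1
     hornerD hornerN hornerXn hornerC exprM.
have nroot b : b \in rs -> (map_poly intr h2).[b] * (map_poly intr h1).[b] != 0.
  by move=> brs; rewrite evalE subr_eq0 -exprM root_expr_neq1.
have [q [g fqg]] := divides_mod_lift m_gt1 f_div.
have ge1 : m%:R ^+ n.-1 <= \prod_(b <- rs) normc (map_poly intr h1).[b].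
  rewrite -[in leLHS]sh1; apply: prod_norm_roots_ge fE mh1 _ fqg _.
    by rewrite sh1.
  by move=> b /nroot; rewrite mulf_eq0 rootE => /norP[].
(* The resultant bound is reused with modulus 1 and the trivial decomposition f = 0 h2 + 1 f. *)
have ge2 : 1 <= \prod_(b <- rs) normc (map_poly intr h2).[b].
  rewrite -[leLHS](expr1n _ (size h2).-1).
  apply: (@prod_norm_roots_ge R f h2 0 f 1 rs fE mh2 sh2).
    by rewrite mul0r add0r scale1r.
  by move=> b /nroot; rewrite mulf_eq0 rootE => /norP[].
have -> : \prod_(b <- rs) normc (1 - (b ^+ n) ^+ k) =
    (\prod_(b <- rs) normc (map_poly intr h2).[b]) *
    \prod_(b <- rs) normc (map_poly intr h1).[b].
  rewrite -big_split; apply: eq_bigr => b _ /=.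
  by rewrite -ComplexField.Normc.normcM evalE -(absvN (normc_absv R)) opprB.
by rewrite -[leLHS]mul1r ler_pM // exprn_ge0 // ler0n.
Qed.

(** [expR (logp b)] is max(1, |b|), so the estimates for |w| <= 1 and |w| >= 1 combine at w = b^n; b
    = 0 is covered by the convention ln 0 = 0. *)
Lemma normc_diff_prod N b :
  normc (diff_prod N (b ^+ n)) <=
    N`!%:R * expR (logp b) ^+ (n * \sum_(j < N) \sum_(i < j) (j - i)) :> R.
Proof.
rewrite -lecR -[(normc _)%:C%C]/(`|diff_prod N (b ^+ n)|).
have [b1|b1] := leP (normc b) 1.
  have -> : logp b = 0 by rewrite /logp (max_idPr _) // ln_le0.
  rewrite expR0 expr1n mulr1 rmorph_nat; apply: norm_diff_prod_le1.
  by rewrite normrX exprn_ile1 // -[ `|b| ]/((normc b)%:C%C) -[1]/(1%:C%C) lecR.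
have -> : expR (logp b) = normc b.
  by rewrite /logp (max_idPl _) ?lnK ?ln_ge0 // ?posrE ?ltW // (lt_trans ltr01).
rewrite rmorphM rmorph_nat rmorphXn exprM -[X in _ <= _ * X ^+ _ ^+ _]/( `|b| ) -normrX.
apply: norm_diff_prod_ge1; rewrite normrX exprn_ege1 //.
by rewrite -[ `|b| ]/((normc b)%:C%C) -[1]/(1%:C%C) lecR ltW.
Qed.

(** Logarithms of two bounds for the product over b of [diff_prod N (b ^+ n)]: each pair i < j
    contributes m^(n-1) from below, and each root one Vandermonde estimate from above. *)
Lemma sum_logp_ineq N :
  (n.-1 * \sum_(j < N) j)%:R * ln m%:R <=
  (size rs)%:R * ln N`!%:R +
  (n * \sum_(j < N) \sum_(i < j) (j - i))%:R * \sum_(b <- rs) logp b.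
Proof.
set e := (n * _)%N.
have mR0 : 0 < m%:R :> R by rewrite ltr0n ltnW.
have NR0 : 0 < N`!%:R :> R by rewrite ltr0n fact_gt0.
have lo : m%:R ^+ (n.-1 * \sum_(j < N) j) <=
    \prod_(b <- rs) normc (diff_prod N (b ^+ n)).
  have -> : \prod_(b <- rs) normc (diff_prod N (b ^+ n)) =
      \prod_(j < N) \prod_(i < j) \prod_(b <- rs) normc (1 - (b ^+ n) ^+ (j - i)).
    rewrite [RHS](eq_bigr (fun j : 'I_N =>
      \prod_(b <- rs) \prod_(i < j) normc (1 - (b ^+ n) ^+ (j - i)))); last first.
      by move=> j _; exact: exchange_big.
    rewrite [RHS]exchange_big; apply: eq_bigr => b _ /=.
    rewrite (big_morph _ (@ComplexField.Normc.normcM R) (@ComplexField.Normc.normc1 R)).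
    apply: eq_bigr => j _.
    by rewrite (big_morph _ (@ComplexField.Normc.normcM R) (@ComplexField.Normc.normc1 R)).
  rewrite exprM -prodrXr; apply: ler_prod => j _.
  rewrite exprn_ge0 ?exprn_ge0 ?ler0n //=.
  rewrite -[X in _ ^+ X](card_ord j) -prodr_const; apply: ler_prod => i _.
  by rewrite exprn_ge0 ?ler0n //= prod_norm_1subX_ge // subn_gt0.
have hi : \prod_(b <- rs) normc (diff_prod N (b ^+ n)) <=
    N`!%:R ^+ size rs * expR (\sum_(b <- rs) logp b) ^+ e.
  rewrite expR_sum -prodrXl.
  have -> : N`!%:R ^+ size rs = \prod_(b <- rs) N`!%:R :> R.
    by rewrite big_const_seq count_predT iter_mulr_1.
  rewrite -big_split; apply: ler_prod => b _.
  by rewrite normc_ge0 normc_diff_prod.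
have lo0 : 0 < m%:R ^+ (n.-1 * \sum_(j < N) j) :> R by rewrite exprn_gt0.
have {}hi := le_trans lo hi; have hi0 := lt_le_trans lo0 hi.
have := hi; rewrite -[_ <= _](ler_ln lo0 hi0).
rewrite lnM ?posrE ?exprn_gt0 ?expR_gt0 // !lnXn ?expR_gt0 // expRK.
by rewrite !mulr_natl.
Qed.

End MahlerMeasure.

(** * Closed forms, choice of N and numerical estimates *)

Lemma sum_ord_id n : ((\sum_(j < n) j) * 2 = n * n.-1)%N.
Proof.
elim: n => [|n IHn]; first by rewrite big_ord0.
by rewrite big_ord_recr /= mulnDl IHn; case: n {IHn} => [|n]; lia.
Qed.

Lemma sum_ord_sub n : ((\sum_(j < n) \sum_(i < j) (j - i)) * 6 = n.-1 * n * n.+1)%N.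
Proof.
have inner j : ((\sum_(i < j) (j - i)) * 2 = j * j.+1)%N.
  elim: j => [|j IHj]; first by rewrite big_ord0.
  by rewrite big_ord_recl subn0 mulnDl IHj /bump /=; lia.
elim: n => [|n IHn]; first by rewrite big_ord0.
rewrite big_ord_recr /= mulnDl IHn -[6%N]/(2 * 3)%N mulnA inner.
by case: n {IHn} => [|n]; lia.
Qed.

Lemma fact_le_expn n : (n`! <= n ^ n)%N.
Proof.
elim: n => // n IHn; rewrite factS expnS leq_mul2l /=.
by apply: leq_trans IHn _; case: n => // n; rewrite leq_exp2r.
Qed.

Section Numeric.
Variable R : realType.

Lemma ln_le_id (x : R) : 0 < x -> ln x <= x.
Proof. by move=> x0; have := @le_ln1Dx R (x - 1); rewrite addrCA subrr addr0; lra. Qed.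

Lemma ln2_ge : 1 / 2 <= ln 2 :> R.
Proof.
have := @le_ln1Dx R (- (1 / 2)); rewrite (_ : 1 + - _ = 2^-1); last by field.
by rewrite lnV ?posrE // => h; have := h ltac:(lra); lra.
Qed.

Lemma ln24_ge (E : R) : 1 <= E -> 2 <= ln (24 * E).
Proof.
move=> E1; have : ln (2 ^+ 4) <= ln (24 * E) by rewrite ler_ln ?posrE; lra.
by rewrite lnXn //; have := ln2_ge; lra.
Qed.

Lemma exists_degree (E : R) : 1 <= E ->
  let T := E * ln (24 * E) in
  exists N : nat, [/\ (1 < N)%N, 64 * T <= N%:R - 1, N%:R <= 65 * T &
    ln N%:R <= 4 * ln (24 * E)].
Proof.
move=> E1 T; have L2 := ln24_ge E1.
have T2 : 2 <= T by rewrite /T; nra.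
have T0 : 0 <= 64 * T by lra.
have := truncn_itv T0; set t := Num.truncn _ => /andP[t1 t2].
(* N is floor(64 T) + 2: the 2 makes N - 1 exceed 64 T, and it is at most T, whence N <= 65 T. *)
exists t.+2; have tS : t.+2%:R = t%:R + 2 :> R by rewrite -addn2 natrD.
have tS1 : t.+1%:R = t%:R + 1 :> R by rewrite -addn1 natrD.
have up : t.+2%:R <= 65 * T by lra.
split=> //; first by lra.
rewrite mulr_natl -lnXn; last lra.
rewrite ler_ln ?posrE ?exprn_gt0 //; last by lra.
apply: le_trans up _.
(* This gives N <= 1560 E^2 <= (24 E)^4. *)
have LE : ln (24 * E) <= 24 * E by apply: ln_le_id; lra.
rewrite /T; have E2 : 1 <= E * E by nra.
apply: (@le_trans _ _ (65 * 24 * (E * E))); first by nra.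
rewrite (_ : (24 * E) ^+ 4 = 24 ^+ 4 * (E * E) * (E * E)); last by ring.
nra.
Qed.

(** Here E = 1/eps, [lm] = log m, D = deg f, [nr] = n, [Nr] = N, [lN] = log N, [lf] = log N! and L =
    log(24 E). With n - 1 >= n/2, D <= n E and lf <= 4 N L, cancelling n N leaves [h1]. *)
Lemma numeric_bound (E lm mu D nr Nr lN L lf : R) : 1 <= E -> 1 / 2 <= lm ->
  0 <= mu -> 2 <= nr -> 0 <= D -> D <= nr * E -> 2 <= L ->
  lf <= Nr * lN ->
  64 * (E * L) <= Nr - 1 -> Nr <= 65 * (E * L) -> 0 <= lN -> lN <= 4 * L ->
  (nr - 1) * (Nr * (Nr - 1) / 2) * lm <=
    D * lf + nr * ((Nr - 1) * Nr * (Nr + 1) / 6) * mu ->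
  lm <= 185 * E * L * mu.
Proof.
move=> E1 lm2 mu0 n2 D0 DE L2 lfN N1 N2 lN0 lN4 main.
have EL : 2 <= E * L by nra.
have Nr0 : 128 <= Nr by lra.
have DlN : D * lf <= nr * E * (Nr * (4 * L)).
  apply: (@le_trans _ _ (D * (Nr * (4 * L)))).
    by apply: ler_wpM2l => //; apply: le_trans lfN _; apply: ler_wpM2l; lra.
  by apply: ler_wpM2r => //; nra.
have c0 : 0 < nr * Nr by nra.
have h1 : nr * Nr * ((Nr - 1) / 4 * lm) <=
    nr * Nr * (4 * (E * L) + (Nr - 1) * (Nr + 1) / 6 * mu).
  apply: (@le_trans _ _ ((nr - 1) * (Nr * (Nr - 1) / 2) * lm)).
    rewrite (_ : nr * Nr * _ = (nr / 2) * ((Nr * (Nr - 1) / 2) * lm)); last by field.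
    rewrite -[leRHS]mulrA; apply: ler_wpM2r; last by lra.
    by rewrite mulr_ge0 ?divr_ge0 ?mulr_ge0 //; lra.
  apply: le_trans main _.
  rewrite (_ : nr * Nr * _ = nr * E * (Nr * (4 * L)) +
    nr * ((Nr - 1) * Nr * (Nr + 1) / 6) * mu); last by field.
  by rewrite lerD2r.
move: h1; rewrite ler_pM2l // => h1.
(* Since N - 1 >= 64 E L and lm >= 1/2, the term 4 E L is at most (N - 1) lm / 8, half of the left
   side. *)
have h2 : (Nr - 1) * (lm / 8) <= (Nr - 1) * ((Nr + 1) / 6 * mu).
  have : 4 * (E * L) <= (Nr - 1) * (lm / 8) by nra.
  lra.
move: h2; rewrite ler_pM2l; last by lra.
(* (4/3)(N + 1) <= (4/3)(65 E L + 1), which is below 185 E L because E L >= 2. *)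
move=> h2; apply: (@le_trans _ _ (4 / 3 * (Nr + 1) * mu)); first by lra.
by apply: ler_wpM2r => //; lra.
Qed.

(** * The explicit bound and the Lehmer constant *)

Lemma height_bound (eps : R) (f : {poly int}) (m n : nat) : 0 < eps -> eps <= 1 ->
  admissible eps f m n ->
  ln m%:R / (185 * eps^-1 * ln (24 * eps^-1)) <= root_height_sum R f.
Proof.
move=> e0 e1 [fm fnc m2]; rewrite ge_max => /andP[n2 nD] fdiv.
have E1 : 1 <= eps^-1 by rewrite invf_ge1.
have L2 := ln24_ge E1.
have [rs fE] : exists rs : seq R[i], map_poly intr f = \prod_(b <- rs) ('X - b%:P).
  have [rs rE] := closed_field_poly_normal (map_poly intr f : {poly R[i]}).
  exists rs; rewrite {1}rE lead_coef_map_inj ?(monicP fm) ?scale1r //; exact: intr_inj.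
apply: le_trans (root_height_sum_ge fm fE).
have n1 : (1 < n)%N by rewrite -(ler_nat R).
have [N [N1 hN1 hN2 hN3]] := exists_degree E1.
have main := sum_logp_ineq fE fnc m2 n1 fdiv N.
have c0 : 0 < 185 * eps^-1 * ln (24 * eps^-1) by rewrite mulr_gt0 //; lra.
rewrite ler_pdivrMr //.
rewrite mulrC.
have szrs : size rs = (size f).-1.
  rewrite -(size_map_inj_poly (intr_inj : injective (intr : int -> R[i]))) //.
  by rewrite fE size_prod_XsubC.
have N1E : N.-1%:R = N%:R - 1 :> R by rewrite -subn1 natrB // ltnW.
have n1E : n.-1%:R = n%:R - 1 :> R by rewrite -subn1 natrB // ltnW.
have sumk : (\sum_(j < N) j)%:R = N%:R * (N%:R - 1) / 2 :> R.
  have /(congr1 (fun k => k%:R : R)) := sum_ord_id N.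
  by rewrite !natrM N1E; lra.
have sume : (\sum_(j < N) \sum_(i < j) (j - i))%:R =
    (N%:R - 1) * N%:R * (N%:R + 1) / 6 :> R.
  have /(congr1 (fun k => k%:R : R)) := sum_ord_sub N.
  by rewrite !natrM N1E -[N.+1%:R]natr1; lra.
move: main; rewrite !natrM sumk sume n1E szrs => main.
have N0 : 0 < N%:R :> R by rewrite ltr0n ltnW.
have m0 : 0 < m%:R :> R by rewrite ltr0n ltnW.
apply: (numeric_bound E1 _ _ n2 _ _ L2 _ hN1 hN2 _ hN3 main).
- by apply: le_trans ln2_ge _; rewrite ler_ln ?posrE // ler_nat.
- by apply: sumr_ge0 => b _; exact: logp_ge0.
- exact: ler0n.
- by rewrite ler_pdivlMr // mulrC.
- rewrite mulr_natl -lnXn // ler_ln ?posrE ?exprn_gt0 // ?ltr0n ?fact_gt0 //.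
  by rewrite -natrX ler_nat fact_le_expn.
- by rewrite ln_ge0 // ler1n ltnW.
Qed.


End Numeric.

Theorem corollary13 (R : realType) (eps : R) (eps_gt0 : 0 < eps)
    (eps_le1 : eps <= 1) :
  (forall (f : {poly int}) (m n : nat), admissible eps f m n ->
     ln m%:R / (185 * eps^-1 * ln (24 * eps^-1)) <= root_height_sum R f) /\
  (exists2 C : R, 0 < C &
     forall f : {poly int}, (exists m n : nat, admissible eps f m n) ->
       C <= root_height_sum R f).
Proof.
have bound f m n : admissible eps f m n ->
  ln m%:R / (185 * eps^-1 * ln (24 * eps^-1)) <= root_height_sum R f.
  exact: height_bound.
split=> //.
have E1 : 1 <= eps^-1 by rewrite invf_ge1.
have c0 : 0 < 185 * eps^-1 * ln (24 * eps^-1).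
  by rewrite mulr_gt0 //; [lra | have := ln24_ge E1; lra].
(* The value of the bound at m = 2, the smallest modulus allowed. *)
exists (ln 2 / (185 * eps^-1 * ln (24 * eps^-1))).
  by rewrite divr_gt0 //; have := @ln2_ge R; lra.
move=> f [m [n adm]]; apply: le_trans (bound _ _ _ adm).
rewrite ler_pM2r ?invr_gt0 //; case: adm => _ _ m2 _ _.
by rewrite ler_ln ?posrE ?ltr0n ?(ltnW m2) // ler_nat.
Qed.
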